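(* For every $n\in\mathbb N$ (with $n\ge 1$) and $1\le p\le\infty$, we have $C_{(\mathbb R^n,\|\cdot\|_p)}=2^n$.
   Context: For a metric space $(X,d)$, write $B(x,r)=\{y\in X: d(x,y)<r\}$ for $x\in X$, $r>0$. All measures $\mu$ on $X$ considered are Borel regular and non-trivial in the sense that $0<\mu(B(x,r))<\infty$ for every $x\in X$ and $r>0$. Such a $\mu$ is called doubling if there is a constant $C\ge 1$ with $\mu(B(x,2r))\le C\mu(B(x,r))$ for all $x\in X$, $r>0$; in that case $C_\mu=\sup_{x\in X,\,r>0}\frac{\mu(B(x,2r))}{\mu(B(x,r))}$. The least doubling constant of $(X,d)$ is $C_{(X,d)}=\inf\{C_\mu:\mu\text{ doubling measure on }(X,d)\}$, with $C_{(X,d)}=\infty$ if no doubling measure exists on $(X,d)$. Here $C_{(\mathbb R^n,\|\cdot\|_p)}$ is the least doubling constant of $\mathbb R^n$ with the metric $d(x,y)=\|x-y\|_p$ induced by the $\ell^p$ norm. *)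

(* Defs.v *)
From HB Require Import structures.
From mathcomp Require Import all_boot all_order all_algebra.
From mathcomp Require Import all_classical all_reals all_analysis.
From mathcomp Require Import ring.

Set Implicit Arguments.
Unset Strict Implicit.
Unset Printing Implicit Defensive.

Import Order.TTheory GRing.Theory Num.Theory.
Import numFieldNormedType.Exports.

Local Open Scope classical_set_scope.
Local Open Scope ring_scope.

Section DoublingMeasures.
Context {R : realType} (X : metricType R).
Local Open Scope ereal_scope.

Definition borel_sets : set (set X) := <<s (@open X) >>.

(* As usual in analysis on metric spaces, a measure on X is an outer measure
   defined on all subsets of X; Borel regularity says that Borel sets are
   Caratheodory measurable and that every set has a Borel hull of the same
   measure. *)
Definition borel_regular (mu : {outer_measure set X -> \bar R}) : Prop :=
  (forall B, borel_sets B -> mu.-caratheodory B) /\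
  (forall A : set X, exists B, [/\ borel_sets B, A `<=` B & mu B = mu A]).

Definition nontrivial_on_balls (mu : {outer_measure set X -> \bar R}) : Prop :=
  forall (x : X) (r : R), (0 < r)%R -> 0 < mu (ball x r) < +oo.

Definition doubling (mu : {outer_measure set X -> \bar R}) : Prop :=
  exists2 C : R, (1 <= C)%R & forall (x : X) (r : R), (0 < r)%R ->
    mu (ball x (2 * r)%R) <= C%:E * mu (ball x r).

Definition doubling_measure (mu : {outer_measure set X -> \bar R}) : Prop :=
  [/\ borel_regular mu, nontrivial_on_balls mu & doubling mu].

Definition doubling_constant (mu : {outer_measure set X -> \bar R}) : \bar R :=
  ereal_sup [set c | exists (x : X) (r : R),
    (0 < r)%R /\ c = mu (ball x (2 * r)%R) / mu (ball x r)].

(* The infimum of the empty set is +oo. *)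
Definition least_doubling_constant : \bar R :=
  ereal_inf [set c | exists2 mu : {outer_measure set X -> \bar R},
    doubling_measure mu & c = doubling_constant mu].

End DoublingMeasures.

Section LpNorm.
Context {R : realType} {n : nat}.
Implicit Types (p : \bar R) (x y z : 'rV[R]_n).

(* The value at p = -oo is junk. *)
Definition lp_norm p x : R :=
  match p with
  | q%:E => (\sum_(i < n) `|x 0 i| `^ q) `^ q^-1
  | +oo%E => \big[Num.max/0]_(i < n) `|x 0 i|
  | -oo%E => 0
  end.

Lemma lp_norm_ge0 p x : 0 <= lp_norm p x.
Proof.
case: p => [q||] //=; first exact: powR_ge0.
by elim/big_ind : _ => // a b a0 b0; rewrite le_max a0.
Qed.

Lemma lp_norm0 p : (1 <= p)%E -> lp_norm p 0 = 0.
Proof.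
case: p => [q||] //=; last first.
  move=> _; apply: big1_idem => [|i _]; first exact: maxxx.
  by rewrite mxE normr0.
rewrite lee_fin => q1.
have q0 : q != 0 by rewrite gt_eqF// (lt_le_trans _ q1).
rewrite big1 ?powR0 ?invr_eq0// => i _.
by rewrite mxE normr0 powR0.
Qed.

Lemma lp_norm_eq0 p x : (1 <= p)%E -> lp_norm p x = 0 -> x = 0.
Proof.
case: p => [q||] //=; last first.
  move=> _ x0; apply/rowP => i; rewrite mxE; apply/eqP.
  rewrite -normr_le0 -x0.
  exact: (le_bigmax_cond _ (fun i => `|x 0 i|)).
rewrite lee_fin => q1 /powR_eq0_eq0 /eqP.
rewrite psumr_eq0 => [|i _]; last exact: powR_ge0.
move=> /allP x0; apply/rowP => i; rewrite mxE; apply/eqP; rewrite -normr_eq0.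
by apply/eqP; move: (x0 i); rewrite mem_index_enum => /(_ isT)/eqP/powR_eq0_eq0.
Qed.

Lemma lp_normN p x : lp_norm p (- x) = lp_norm p x.
Proof.
have E (i : 'I_n) : `|(- x) 0 i| = `|x 0 i| by rewrite mxE normrN.
rewrite /lp_norm; case: p => [q||].
- by congr (_ `^ _); apply: eq_bigr => i _; rewrite E.
- by apply: eq_bigr => i _; rewrite E.
- by [].
Qed.

Lemma lp_normD p x y : (1 <= p)%E ->
  lp_norm p (x + y) <= lp_norm p x + lp_norm p y.
Proof.
move=> p1; have [x0|x0] := eqVneq (lp_norm p x) 0.
  by rewrite x0 (lp_norm_eq0 p1 x0) !add0r.
have [y0|y0] := eqVneq (lp_norm p y) 0.
  by rewrite y0 (lp_norm_eq0 p1 y0) !addr0.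
have {}x0 : 0 < lp_norm p x by rewrite lt_def x0 lp_norm_ge0.
have {}y0 : 0 < lp_norm p y by rewrite lt_def y0 lp_norm_ge0.
case: p p1 x0 y0 => [q||] //=; last first.
  move=> _ _ _; apply/bigmax_leP; split=> [|i _].
    by apply: addr_ge0; exact: (lp_norm_ge0 +oo%E).
  rewrite mxE (le_trans (ler_normD _ _))// lerD//.
    exact: (le_bigmax_cond _ (fun i => `|x 0 i|)).
  exact: (le_bigmax_cond _ (fun i => `|y 0 i|)).
rewrite lee_fin => q1.
have q0 : 0 < q by rewrite (lt_le_trans _ q1).
have E (z : 'rV[R]_n) : \sum_(i < n) `|z 0 i| `^ q =
    ((\sum_(i < n) `|z 0 i| `^ q) `^ q^-1) `^ q.
  by rewrite -powRrM mulVf ?gt_eqF// powRr1// sumr_ge0// => i _; exact: powR_ge0.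
move: (E x) (E y).
move: ((\sum_(i < n) `|x 0 i| `^ q) `^ q^-1) => a.
move: ((\sum_(i < n) `|y 0 i| `^ q) `^ q^-1) => b Ex Ey a0 b0.
have s0 : 0 < a + b by exact: addr_gt0.
have t01 : 0 <= a / (a + b) <= 1.
  by rewrite divr_ge0 ?(ltW a0) ?(ltW s0)//= ler_pdivrMr// mul1r lerDl ltW.
have tE : 1 - a / (a + b) = b / (a + b).
  by field; rewrite gt_eqF.
have key i : `|(x + y) 0 i| `^ q <= (a + b) `^ q *
    (a / (a + b) * (`|x 0 i| `^ q / a `^ q) +
     b / (a + b) * (`|y 0 i| `^ q / b `^ q)).
  have xa0 : 0 <= `|x 0 i| / a by rewrite divr_ge0// ltW.
  have yb0 : 0 <= `|y 0 i| / b by rewrite divr_ge0// ltW.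
  have cvx : (a / (a + b) * (`|x 0 i| / a) + b / (a + b) * (`|y 0 i| / b)) `^ q
      <= a / (a + b) * (`|x 0 i| / a) `^ q + b / (a + b) * (`|y 0 i| / b) `^ q.
    rewrite -tE; case/andP: t01 => t0 t1.
    by apply: (convex_powR q1 (Itv01 t0 t1));
      rewrite inE/= in_itv/= andbT.
  have V (c u : R) : 0 < c -> 0 <= u -> (u / c) `^ q = u `^ q / c `^ q.
    by move=> c0 u0; rewrite powRM ?invr_ge0 ?(ltW c0)// -powR_inv1 ?(ltW c0)//
      powRAC powR_inv1// powR_ge0.
  rewrite -!V//; apply: le_trans (ler_wpM2l (powR_ge0 _ _) cvx).
  rewrite -powRM ?(ltW s0)//; last first.
    by rewrite addr_ge0// mulr_ge0// divr_ge0// ltW.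
  apply: ge0_ler_powR; first exact: ltW.
  - by rewrite nnegrE.
  - by rewrite nnegrE mulr_ge0 ?(ltW s0)// addr_ge0// mulr_ge0// divr_ge0// ltW.
  have -> : (a + b) *
      (a / (a + b) * (`|x 0 i| / a) + b / (a + b) * (`|y 0 i| / b)) =
      `|x 0 i| + `|y 0 i|.
    by field; rewrite !gt_eqF.
  by rewrite mxE ler_normD.
have le_sum : \sum_(i < n) `|(x + y) 0 i| `^ q <= (a + b) `^ q.
  apply: (le_trans (ler_sum _ (fun i _ => key i))).
  rewrite -mulr_sumr big_split/= -!mulr_sumr -!mulr_suml Ex Ey.
  rewrite !divff ?gt_eqF ?powR_gt0// !mulr1 -mulrDl divff ?gt_eqF//.
  by rewrite mulr1.
apply: (@le_trans _ _ (((a + b) `^ q) `^ q^-1)).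
  apply: ge0_ler_powR; rewrite ?nnegrE ?invr_ge0 ?powR_ge0 ?(ltW q0)//.
  by rewrite sumr_ge0// => i _; exact: powR_ge0.
by rewrite -powRrM divff ?gt_eqF// powRr1// ltW.
Qed.

End LpNorm.

(* R^n with the metric induced by the l^p norm; the alias keeps it apart from
   the max-norm topology carried by 'rV[R]_n. *)
Definition lp_space (R : realType) (n : nat) (p : \bar R) (p_ge1 : (1 <= p)%E)
  : Type := 'rV[R]_n.

Arguments lp_space {R} n {p} p_ge1.

Section LpSpace.
Context {R : realType} {n : nat} {p : \bar R} (p_ge1 : (1 <= p)%E).
Local Notation X := (lp_space n p_ge1).

HB.instance Definition _ := Choice.copy X 'rV[R]_n.

Definition lp_dist (x y : X) : R := lp_norm p ((x : 'rV[R]_n) - y).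

Let lp_distxx x : lp_dist x x = 0.
Proof. by rewrite /lp_dist subrr lp_norm0. Qed.

Let lp_dist_positivity x y : lp_dist x y = 0 -> x = y.
Proof. by move=> /(lp_norm_eq0 p_ge1)/eqP; rewrite subr_eq0 => /eqP. Qed.

Let lp_dist_sym x y : lp_dist x y = lp_dist y x.
Proof. by rewrite /lp_dist -lp_normN opprB. Qed.

Let lp_dist_triangle y x z : lp_dist x z <= lp_dist x y + lp_dist y z.
Proof.
rewrite /lp_dist; apply: le_trans (lp_normD _ _ p_ge1).
by rewrite addrA subrK.
Qed.

HB.instance Definition _ := @isMetric.Build R X
  lp_dist lp_distxx lp_dist_positivity lp_dist_sym lp_dist_triangle.

End LpSpace.

(* Main.v *)
(* For the upper bound, Lebesgue outer measure (the infimum over countable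
   covers by half-open boxes of the total volume) scales by 2^n under
   y |-> 2y - x, which maps B(x, r) onto B(x, 2r); the ratio in the doubling
   constant is thus always 2^n. Half-spaces are Caratheodory measurable
   because they split boxes into boxes.
   For the lower bound, if mu has doubling constant C then a unit ball
   contained in a ball of radius 2^k carries at least the fraction C^-(k+O(1))
   of its mass. A ball of radius 2^(k+O(1)) contains 2^(kn) disjoint unit balls
   centred on the grid 2Z^n, so 2^(kn) <= C^(k+O(1)) for all k. *)
From HB Require Import structures.
Require Import Defs.
From mathcomp Require Import all_boot all_order all_algebra.
From mathcomp Require Import all_classical all_reals all_analysis.
From mathcomp Require Import measurable_realfun zify ring lra.

Set Implicit Arguments.
Unset Strict Implicit.
Unset Printing Implicit Defensive.

Import Order.TTheory GRing.Theory Num.Theory.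
Import numFieldNormedType.Exports.

Local Open Scope classical_set_scope.
Local Open Scope ring_scope.

(** * Outer measures generated by countable weighted covers *)

Section CoverOuterMeasure.
Context {R : realType} {T I : Type} (Q : I -> set T) (v : I -> R).
Local Open Scope ereal_scope.

(** Caratheodory's construction. A cover is always a full sequence, so a finite cover has to be
    padded with members of weight 0; a set without covers gets [+oo]. *)
Definition cover_outer (A : set T) : \bar R :=
  ereal_inf [set \sum_(k <oo) (v (F k))%:E |
    F in [set F : nat -> I | A `<=` \bigcup_k Q (F k)]].

Lemma cover_outer_le A (F : nat -> I) :
  A `<=` \bigcup_k Q (F k) -> cover_outer A <= \sum_(k <oo) (v (F k))%:E.
Proof. by move=> AF; apply: ereal_inf_lbound; exists F. Qed.

Lemma le_cover_outer (A : set T) x :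
  (forall F : nat -> I, A `<=` \bigcup_k Q (F k) ->
    x <= \sum_(k <oo) (v (F k))%:E) -> x <= cover_outer A.
Proof. by move=> H; apply: le_ereal_inf_tmp => _ [F AF <-]; exact: H. Qed.

Lemma cover_outer_mono : {homo cover_outer : A B / A `<=` B >-> A <= B}.
Proof.
move=> A B AB; apply: le_cover_outer => F BF.
by apply: cover_outer_le; exact: subset_trans BF.
Qed.

Hypothesis v_ge0 : forall i, (0 <= v i)%R.

Lemma cover_outer_ge0 A : 0 <= cover_outer A.
Proof.
by apply: le_cover_outer => F _; apply: nneseries_ge0 => k _ _; rewrite lee_fin.
Qed.

Lemma cover_outer_adherent A (e : R) : (0 < e)%R -> cover_outer A < +oo ->
  exists2 F : nat -> I, A `<=` \bigcup_k Q (F k) &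
    \sum_(k <oo) (v (F k))%:E <= cover_outer A + e%:E.
Proof.
move=> e0 Aoo.
have /(lb_ereal_inf_adherent e0)[_ [F AF <-] /ltW Fe] : cover_outer A \is a fin_num.
  by rewrite ge0_fin_numE// cover_outer_ge0.
by exists F.
Qed.

(** Covers of the [A n] that are optimal up to e / 2^(n+1) are merged into one sequence, at a total
    loss of at most e. *)
Lemma cover_outer_sigma_subadditive : sigma_subadditive cover_outer.
Proof.
move=> A; have [[i ioo]|] := pselect (exists i, cover_outer (A i) = +oo).
  rewrite (eseries_pinfty _ _ ioo) ?leey// => n _.
  by rewrite -ltNye (lt_le_trans _ (cover_outer_ge0 _)).
rewrite -forallNE => Aoo; apply/lee_addgt0Pr => e e0.
rewrite (le_trans _ (epsilon_trick _ _ (ltW e0)))//; last first.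
  by move=> n; exact: cover_outer_ge0.
have /choice[G PG] n : exists F : nat -> I, A n `<=` \bigcup_k Q (F k) /\
    \sum_(k <oo) (v (F k))%:E <= cover_outer (A n) + (e / (2 ^ n.+1)%:R)%:E.
  have [||F AF Fe] := @cover_outer_adherent (A n) (e / (2 ^ n.+1)%:R)%R.
  - by rewrite divr_gt0// ltr0n expn_gt0.
  - by rewrite ltey; apply/eqP.
  - by exists F.
pose w (p : nat * nat) := (v (G p.1 p.2))%:E.
have w0 p : 0 <= w p by rewrite lee_fin.
(* The bijection [f] from [nat] to [nat * nat] enumerates the doubly indexed cover; since the
   weights are nonnegative, its sum can be regrouped into the iterated sum. *)
have /card_esym/ppcard_eqP[f] := card_nat2.
apply: (@le_trans _ _ (\sum_(k <oo) w (f k))).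
  apply: (@cover_outer_le _ (fun k => G (f k).1 (f k).2)) => t [i _ Ait].
  have [j _ tj] := (PG i).1 _ Ait.
  by exists (f^-1%FUN (i, j)) => //=; rewrite invK ?inE.
have -> : \sum_(k <oo) w (f k) = \esum_(p in setT) w p.
  by rewrite nneseries_esumT// (reindex_esum setT setT f).
have -> : \esum_(p in setT) w p = \sum_(i <oo) \sum_(j <oo) w (i, j).
  rewrite nneseries_esumT; last by move=> i; exact: nneseries_ge0.
  under [RHS]eq_esum do rewrite nneseries_esumT//.
  rewrite esum_esum//; congr esum.
  apply/seteqP; split => //.
apply: lee_nneseries => [i _ _|i _]; first exact: nneseries_ge0.
exact: (PG i).2.
Qed.

End CoverOuterMeasure.

Section CoverOuterHull.
Context {R : realType} {T I : Type} (Q : I -> set T) (v : I -> R).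
Local Open Scope ereal_scope.

(** The hull is a countable intersection of covers whose weights approach the infimum; when the
    infimum is [+oo], the whole space serves. *)
Lemma cover_outer_hull (G : set (set T)) : (forall i, (0 <= v i)%R) ->
  (forall i, <<s G >> (Q i)) -> forall A, exists B,
    [/\ <<s G >> B, A `<=` B & cover_outer Q v B = cover_outer Q v A].
Proof.
move=> v0 GQ A; have [G0 GC GU] := smallest_sigma_algebra [set: T] G.
have {}GC B : <<s G >> B -> <<s G >> (~` B) by rewrite -setTD; exact: GC.
have [Aoo|] := ltP (cover_outer Q v A) +oo; last first.
  rewrite leye_eq => /eqP Aoo; exists setT; split => //.
    by have := GC _ G0; rewrite setC0.
  by apply/eqP; rewrite Aoo -leye_eq -Aoo cover_outer_mono.
have /choice[F PF] n : exists F : nat -> I, A `<=` \bigcup_k Q (F k) /\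
    \sum_(k <oo) (v (F k))%:E <= cover_outer Q v A + n.+1%:R^-1%:E.
  have [||F AF Fe] := @cover_outer_adherent _ _ _ Q v v0 A n.+1%:R^-1 => //.
  by exists F.
exists (\bigcap_n \bigcup_k Q (F n k)); split.
- rewrite -[X in _ X]setCK setC_bigcap; apply: (GC); apply: (GU) => n.
  by apply: (GC); apply: (GU) => k.
- by move=> x Ax n _; exact: (PF n).1.
- apply/eqP; rewrite eq_le; apply/andP; split; last first.
    by apply: cover_outer_mono => x Ax n _; exact: (PF n).1.
  apply/lee_addgt0Pr => e e0.
  (* With this [n], 1/e < n + 1, so the error 1/(n + 1) is below e. *)
  pose n := Num.truncn e^-1.
  apply: (@le_trans _ _ (cover_outer Q v A + n.+1%:R^-1%:E)).
    apply: le_trans (PF n).2; apply: cover_outer_le => x; exact.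
  rewrite leeD2l// lee_fin invf_ple ?posrE//.
  by apply/ltW; rewrite truncnS_gt.
Qed.

End CoverOuterHull.

(** * Half-open boxes and countable subadditivity of their volume *)

Section Boxes.
Context {R : realType}.

Definition box n (p : 'rV[R]_n * 'rV[R]_n) : set 'rV[R]_n :=
  [set x | forall i, p.1 0 i <= x 0 i < p.2 0 i].

(** Truncation at 0 gives volume 0 to boxes with reversed ends. In dimension 0 the only box is a
    point, and its volume is the empty product 1. *)
Definition vol n (p : 'rV[R]_n * 'rV[R]_n) : R :=
  \prod_i Num.max (p.2 0 i - p.1 0 i) 0.

Lemma vol_ge0 n (p : 'rV[R]_n * 'rV[R]_n) : 0 <= vol p.
Proof. by apply: prodr_ge0 => i _; rewrite le_max lexx orbT. Qed.

Local Open Scope ereal_scope.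

Lemma lebesgue_measure_itvco (a b : R) :
  lebesgue_measure `[a, b[%classic = (Num.max (b - a) 0)%:E.
Proof.
rewrite lebesgue_measure_itv/= lte_fin.
case: ltP => ab; first by rewrite max_l// subr_ge0 ltW.
by rewrite max_r// subr_le0.
Qed.

(* Integrating in the first coordinate: a point of the first side of the box
   only sees the boxes of the cover whose first side contains it, and these
   cover the corresponding slice. *)
Lemma vol_le_cover n (p : 'rV[R]_n * 'rV[R]_n) (K : pred nat)
    (F : nat -> 'rV[R]_n * 'rV[R]_n) :
  box p `<=` \bigcup_(k in [set k | K k]) box (F k) ->
  (vol p)%:E <= \sum_(k <oo | K k) (vol (F k))%:E.
Proof.
elim: n p K F => [|n IH] p K F pF.
  have [|k Kk _] := pF 0%R; first by case.
  rewrite eseries_mkcond (@nneseriesD1 _ _ k)//; last first.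
    by move=> i _; case: ifP => // _; rewrite lee_fin vol_ge0.
  rewrite Kk /vol !big_ord0 leeDl// nneseries_ge0// => i _ _.
  by case: ifP => // _; rewrite big_ord0 lee_fin.
(* A box is the product of its first side [I q] and the box [sl q] in the remaining coordinates;
   [g k x] is the volume of the slice of box k at first coordinate x. *)
pose sl (q : 'rV[R]_n.+1 * 'rV[R]_n.+1) := (col' ord0 q.1, col' ord0 q.2).
pose I (q : 'rV[R]_n.+1 * 'rV[R]_n.+1) : set R := `[q.1 ord0 ord0, q.2 ord0 ord0[%classic.
have mI q : measurable (I q) by exact: measurable_itv.
have volS q : (vol q)%:E = (vol (sl q))%:E * lebesgue_measure (I q).
  rewrite lebesgue_measure_itvco -EFinM mulrC /vol big_ord_recl; congr (_ * _)%:E.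
  by apply: eq_bigr => i _; rewrite !mxE.
pose g k x : \bar R := if K k then (vol (sl (F k)))%:E * (\1_(I (F k)) x)%:E else 0.
have g0 k x : 0 <= g k x.
  by rewrite /g; case: ifP => // _; rewrite mule_ge0// lee_fin ?vol_ge0.
have mg k : measurable_fun (I p) (g k).
  rewrite /g; case: (K k) => //; apply/measurable_EFinP.
  by apply: measurable_funM => //.
have slice x : I p x -> (vol (sl p))%:E <= \sum_(k <oo) g k x.
  (* The selector [K] in the statement makes the induction hypothesis applicable to the subfamily of
     boxes that meet the slice at x. *)
  move=> px; have := IH (sl p) (fun k => K k && (x \in I (F k))) (sl \o F).
  rewrite eseries_mkcond => le_sl; apply: (le_trans (le_sl _)).
    move=> y py; pose z : 'rV[R]_n.+1 :=
      \row_i (if unlift ord0 i is Some j then y ord0 j else x).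
    have z0 : z ord0 ord0 = x by rewrite mxE unlift_none.
    have zS j : z ord0 (lift ord0 j) = y ord0 j by rewrite mxE liftK.
    have [i|k Kk zk] := pF z.
      case: (unliftP ord0 i) => [j|] ->; last by rewrite z0; move: px; rewrite /I/= in_itv.
      by rewrite zS; have := py j; rewrite /sl/= !mxE.
    exists k => /=.
      by rewrite [K k]Kk/=; rewrite inE /I/= in_itv/= -z0; exact: zk.
    by move=> j; rewrite /sl/= !mxE -zS; exact: zk.
  apply: lee_nneseries => [k _ _|k _].
    by case: ifP => // _; rewrite lee_fin vol_ge0.
  rewrite /g indicE; case: (K k) => //=; case: ifP => _; rewrite ?mule1 ?mule0//.
(* The slice inequality is integrated over [I p], and the sum and the integral are exchanged, the
   terms being nonnegative. *)
rewrite volS -integral_cst; last exact: mI.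
apply: (@le_trans _ _ (\int[lebesgue_measure]_(x in I p) \sum_(k <oo) g k x)).
  apply: ge0_le_integral => //.
  - exact: mI.
  - by move=> x _; rewrite lee_fin vol_ge0.
  - by apply: (@ge0_emeasurable_sum _ _ _ _ g predT) => //; exact: mI.
rewrite integral_nneseries//; last exact: mI.
rewrite [leRHS]eseries_mkcond; apply: lee_nneseries => [k _ _|k _].
  exact: integral_ge0.
rewrite /g; case: (K k); last by rewrite integral0.
rewrite ge0_integralZl//.
- rewrite volS lee_wpmul2l ?lee_fin ?vol_ge0// integral_indic; [|exact: mI..].
  apply: le_measure; rewrite ?inE; [|exact: mI|exact: subIsetl].
  by apply: measurableI; exact: mI.
- exact: mI.
- by apply: measurableT_comp => //; apply: measurable_indic; exact: mI.
- by rewrite lee_fin vol_ge0.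
Qed.

End Boxes.

(** * Lebesgue outer measure: value on boxes, scaling, measurability *)

Section LebesgueOuter.
Context {R : realType} {n : nat}.
Implicit Types (p : 'rV[R]_n.+1 * 'rV[R]_n.+1) (A : set 'rV[R]_n.+1) (i : 'I_n.+1).
Local Open Scope ereal_scope.

(** These degenerate boxes pad finite covers. In dimension 0 they would have volume 1, hence the
    dimension [n.+1]. *)
Lemma vol_pt (a : 'rV[R]_n.+1) : vol (a, a) = 0%R.
Proof. by rewrite /vol big_ord_recl subrr maxxx mul0r. Qed.

Definition lebesgue_outer : set 'rV[R]_n.+1 -> \bar R :=
  cover_outer (@box R n.+1) (@vol R n.+1).

Lemma lebesgue_outer_box p : lebesgue_outer (box p) = (vol p)%:E.
Proof.
apply/eqP; rewrite eq_le; apply/andP; split; last first.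
  apply: le_cover_outer => F pF; apply: (@vol_le_cover _ _ _ predT).
  by rewrite (_ : [set k | predT k] = setT)//; apply/seteqP.
pose F k : 'rV[R]_n.+1 * 'rV[R]_n.+1 := if k == 0%N then p else (0%R, 0%R).
apply: (@le_trans _ _ (\sum_(k <oo) (vol (F k))%:E)).
  by apply: cover_outer_le => x px; exists 0%N.
rewrite (@nneseriesD1 _ _ 0%N)//=; last by move=> k _; rewrite lee_fin vol_ge0.
by rewrite eseries0 ?adde0// => -[|k]// _ _; rewrite /= vol_pt.
Qed.

Lemma lebesgue_outer0 : lebesgue_outer set0 = 0.
Proof.
apply/eqP; rewrite eq_le cover_outer_ge0 ?andbT; last exact: vol_ge0.
rewrite -[X in _ <= X]/(0%:E) -(vol_pt 0) -lebesgue_outer_box.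
exact: cover_outer_mono.
Qed.

HB.instance Definition _ := isOuterMeasure.Build R 'rV[R]_n.+1 lebesgue_outer
  lebesgue_outer0 (cover_outer_ge0 _ (@vol_ge0 R n.+1))
  (@cover_outer_mono _ _ _ (@box R n.+1) (@vol R n.+1))
  (cover_outer_sigma_subadditive _ (@vol_ge0 R n.+1)).

(** The map sends a cover by boxes to a cover by boxes, each side being multiplied by s. *)
Let affine_le (s : R) (c : 'rV[R]_n.+1) A : (0 < s)%R ->
  lebesgue_outer [set (c + s *: y)%R | y in A] <= (s ^+ n.+1)%:E * lebesgue_outer A.
Proof.
move=> s0; have sn0 : (0 < s ^+ n.+1)%R by rewrite exprn_gt0.
rewrite -lee_pdivrMl//; apply: le_cover_outer => F AF.
rewrite lee_pdivrMl// -nneseriesZl; last by move=> k _; rewrite lee_fin vol_ge0.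
pose G k := ((c + s *: (F k).1)%R, (c + s *: (F k).2)%R).
have -> : \sum_(k <oo) ((s ^+ n.+1)%:E * (vol (F k))%:E) =
    \sum_(k <oo) (vol (G k))%:E.
  apply: eq_eseriesr => k _; rewrite -EFinM; congr EFin.
  rewrite /vol -{1}[n.+1]card_ord -prodr_const -big_split/=; apply: eq_bigr => i _.
  by rewrite !mxE opprD addrACA subrr add0r -mulrBr maxr_pMr ?mulr0// ltW.
apply: cover_outer_le => _ [y Ay <-]; have [k _ Fy] := AF _ Ay.
exists k => // i; rewrite !mxE lerD2l ltrD2l ler_pM2l// ltr_pM2l//.
Qed.

(** The missing inequality is [affine_le] for the inverse map. *)
Lemma lebesgue_outer_affine (s : R) (c : 'rV[R]_n.+1) A : (0 < s)%R ->
  lebesgue_outer [set (c + s *: y)%R | y in A] = (s ^+ n.+1)%:E * lebesgue_outer A.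
Proof.
move=> s0; apply/eqP; rewrite eq_le affine_le//=.
have sV0 : (0 < s^-1)%R by rewrite invr_gt0.
have sn0 : (0 < s ^+ n.+1)%R by rewrite exprn_gt0.
rewrite -lee_pdivlMl// -exprVn.
apply: le_trans (affine_le (- (s^-1 *: c)) _ sV0).
rewrite image_comp; apply: cover_outer_mono => y Ay; exists y => //=.
by rewrite scalerDr addKr scalerA mulVf ?gt_eqF// scale1r.
Qed.

Lemma halfspace_caratheodory i (c : R) :
  lebesgue_outer.-caratheodory [set x | (x ord0 i < c)%R].
Proof.
apply: le_caratheodory_measurable => A; apply: le_cover_outer => F AF.
pose upd (x : 'rV[R]_n.+1) (t : R) : 'rV[R]_n.+1 :=
  \row_j (if j == i then t else x ord0 j).
(* [G k] and [H k] are the parts of [F k] below and above the hyperplane; if one part is empty, its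
   volume is 0 by truncation. *)
pose G k := ((F k).1, upd (F k).2 (Num.min ((F k).2 ord0 i) c)).
pose H k := (upd (F k).1 (Num.max ((F k).1 ord0 i) c), (F k).2).
have -> : \sum_(k <oo) (vol (F k))%:E =
    \sum_(k <oo) (vol (G k))%:E + \sum_(k <oo) (vol (H k))%:E.
  rewrite -nneseriesD; [|by move=> *; rewrite lee_fin vol_ge0..].
  apply: eq_eseriesr => k _; rewrite -EFinD; congr EFin.
  have volD1 q : vol q = (Num.max (q.2 ord0 i - q.1 ord0 i) 0 *
      \prod_(j | j != i) Num.max (q.2 ord0 j - q.1 ord0 j) 0)%R.
    by rewrite /vol (bigD1 i).
  rewrite !volD1/= !mxE eqxx.
  set P := (\prod_(j | _) _)%R.
  rewrite (eq_bigr (fun j => Num.max ((F k).2 ord0 j - (F k).1 ord0 j) 0)%R); last first.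
    by move=> j /negPf ji; rewrite !mxE ji.
  rewrite [X in _ = (_ + _ * X)%R](eq_bigr (fun j => Num.max ((F k).2 ord0 j - (F k).1 ord0 j) 0)%R); last first.
    by move=> j /negPf ji; rewrite !mxE ji.
  rewrite -/P -mulrDl; congr (_ * _)%R.
  (* With the common factor removed, what remains is that cutting an interval at c preserves its
     truncated length. *)
  move: ((F k).1 ord0 i) ((F k).2 ord0 i) => a b.
  rewrite /Num.max /Num.min; do ![case: ifPn] => *; lra.
apply: leeD; apply: cover_outer_le => x [Ax xc]; have [k _ Fx] := AF _ Ax;
    exists k => // j; rewrite !mxE; have := Fx j; case: eqP => // ->.
  by rewrite lt_min => /andP[-> ->]; rewrite xc.
by rewrite ge_max => /andP[-> ->]; rewrite andbT/= leNgt; exact/negP.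
Qed.

(** The generator is left arbitrary to serve both the Caratheodory measurable sets and the Borel
    sets. *)
Lemma box_halfspaces (G : set (set 'rV[R]_n.+1)) :
  (forall i c, <<s G >> [set x | (x ord0 i < c)%R]) -> forall p, <<s G >> (box p).
Proof.
move=> GH p.
have -> : box p = \bigcap_(i in [set: 'I_n.+1])
    (~` [set x | (x ord0 i < p.1 ord0 i)%R] `&` [set x | (x ord0 i < p.2 ord0 i)%R]).
  apply/seteqP; split => [x px i _|x px i].
    by have /andP[] := px i; split => //=; apply/negP; rewrite -leNgt.
  by have [/= /negP + ->] := px i I; rewrite -leNgt => ->.
apply: (@fin_bigcap_measurable _ (g_sigma_algebraType G)) => // i _.
apply: measurableI; last exact: GH.
by apply: measurableC; exact: GH.
Qed.

End LebesgueOuter.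

(** * The lp norm compared with coordinates, and its homogeneity *)

Section LpNormTheory.
Context {R : realType} {n : nat} (p : \bar R) (p_ge1 : (1 <= p)%E).
Implicit Types x y : 'rV[R]_n.+1.

Lemma ler_coord_lp_norm x i : `|x ord0 i| <= lp_norm p x.
Proof.
case: p p_ge1 => [q||] //=; last first.
  by move=> _; exact: (le_bigmax_cond _ (fun i => `|x 0 i|)).
rewrite lee_fin => q1; have q0 : 0 < q by exact: lt_le_trans q1.
rewrite -[leLHS]powRr1// -[X in _ `^ X](divff (lt0r_neq0 q0)) powRrM.
apply: ge0_ler_powR; rewrite ?nnegrE ?invr_ge0 ?powR_ge0 ?(ltW q0)//.
  by rewrite sumr_ge0// => j _; exact: powR_ge0.
by rewrite (bigD1 i)//= lerDl sumr_ge0// => j _; exact: powR_ge0.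
Qed.

(** For finite q the factor that arises is (n + 1)^(1/q); bounding it by n + 1 gives one estimate
    for all exponents. *)
Lemma lp_norm_le_coord x c : (forall i, `|x ord0 i| <= c) ->
  lp_norm p x <= n.+1%:R * c.
Proof.
move=> xc; have c0 : 0 <= c by exact: le_trans (xc ord0).
case: p p_ge1 => [q||] //=; last first.
  move=> _; apply/bigmax_leP; split => [|i _]; first by rewrite mulr_ge0.
  by rewrite (le_trans (xc i))// ler_peMl// ler1n.
rewrite lee_fin => q1; have q0 : 0 < q by exact: lt_le_trans q1.
apply: (@le_trans _ _ ((n.+1%:R * c `^ q) `^ q^-1)).
  apply: ge0_ler_powR; rewrite ?nnegrE ?invr_ge0 ?(ltW q0)//.
  - by rewrite sumr_ge0// => j _; exact: powR_ge0.
  - by rewrite mulr_ge0// powR_ge0.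
  rewrite mulr_natl -[X in _ *+ X]card_ord -sumr_const; apply: ler_sum => i _.
  by apply: ge0_ler_powR; rewrite ?nnegrE ?(ltW q0).
rewrite powRM ?powR_ge0// -powRrM divff ?gt_eqF// powRr1// ler_wpM2r//.
rewrite -[leRHS]powRr1//; apply: ler_powR; first by rewrite ler1n.
by rewrite invf_le1.
Qed.

Lemma lp_normZ (s : R) x : 0 <= s -> lp_norm p (s *: x) = s * lp_norm p x.
Proof.
move=> s0; case: p p_ge1 => [q||] //=; last first.
  move=> _; rewrite (big_morph ( *%R s) (fun u v => maxr_pMr u v s0) (mulr0 s)).
  by apply: eq_bigr => i _; rewrite mxE normrM ger0_norm.
rewrite lee_fin => q1; have q0 : 0 < q by exact: lt_le_trans q1.
under eq_bigr do rewrite mxE normrM ger0_norm// powRM//.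
rewrite -mulr_sumr powRM ?powR_ge0//; last first.
  by rewrite sumr_ge0// => i _; exact: powR_ge0.
by rewrite -powRrM divff ?gt_eqF// powRr1.
Qed.

End LpNormTheory.

Lemma metric_ball_open {R : realType} (X : metricType R) (x : X) (r : R) :
  open (ball x r).
Proof.
rewrite openE => y; rewrite ballEmdist/= => xy; apply/nbhs_ballP.
exists (r - mdist x y); first by rewrite /= subr_gt0.
move=> z; rewrite !ballEmdist/= => yz.
by rewrite (le_lt_trans (metric_triangle x y z))// -ltrBrDl.
Qed.

(** * Upper bound: Lebesgue outer measure on the lp space *)

Section LpLebesgue.
Context {R : realType} {n : nat} (p : \bar R) (p_ge1 : (1 <= p)%E).
Local Notation X := (lp_space n.+1 p_ge1).
Local Open Scope ereal_scope.

Lemma lp_ballE (x : X) (r : R) :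
  ball x r = [set y : X | (lp_norm p ((x : 'rV[R]_n.+1) - y) < r)%R].
Proof. by []. Qed.

Lemma open_halfspace (i : 'I_n.+1) (c : R) :
  open ([set x : 'rV[R]_n.+1 | (x ord0 i < c)%R] : set X).
Proof.
rewrite openE => x /= xc; apply/nbhs_ballP; exists (c - x ord0 i)%R.
  by rewrite /= subr_gt0.
move=> y; rewrite lp_ballE/= => xy.
have := le_lt_trans (ler_coord_lp_norm p_ge1 _ i) xy.
by rewrite !mxE distrC ltr_norml => /andP[_]; rewrite ltrD2r.
Qed.

Let Q (q : 'rV[rat]_n.+1 * 'rV[rat]_n.+1) :=
  box (map_mx (@ratr R) q.1, map_mx (@ratr R) q.2).

(** Rational corners make the family of boxes countable, so that open sets become measurable once
    boxes are. *)
Lemma open_bigcup_box (U : set X) : open U ->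
  U = \bigcup_(q in [set q | Q q `<=` U]) Q q.
Proof.
move=> oU; apply/seteqP; split => [x Ux|x [q qU]]; last exact: qU.
have /nbhs_ballP[r /= r0 rU] : nbhs x U by exact: open_nbhs_nbhs.
(* Coordinates within d give norm at most (n + 1) d, and the denominator n + 2 makes this strictly
   less than r. *)
pose d := (r / n.+2%:R)%R; have d0 : (0 < d)%R by rewrite divr_gt0.
have /choice[a xa] i : exists a : rat, (x ord0 i - d < ratr a < x ord0 i)%R.
  have /rat_in_itvoo[a] : (x ord0 i - d < x ord0 i)%R by rewrite ltrBlDr ltrDl.
  by rewrite in_itv; exists a.
have /choice[b xb] i : exists b : rat, (x ord0 i < ratr b < x ord0 i + d)%R.
  have /rat_in_itvoo[b] : (x ord0 i < x ord0 i + d)%R by rewrite ltrDl.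
  by rewrite in_itv; exists b.
exists (\row_i a i, \row_i b i); last first.
  move=> i; rewrite !mxE; have /andP[_ /ltW->] := xa i.
  by have /andP[->] := xb i.
move=> y yQ; apply: rU; rewrite lp_ballE/=.
apply: (@le_lt_trans _ _ (n.+1%:R * d)%R).
  apply: lp_norm_le_coord => // i; rewrite !mxE.
  have := yQ i; rewrite !mxE => /andP[ay yb].
  have /andP[ax _] := xa i; have /andP[_ bx] := xb i.
  by rewrite ler_norml; apply/andP; split; lra.
by rewrite /d mulrCA gtr_pMr// ltr_pdivrMr// mul1r ltr_nat.
Qed.

Definition lp_lebesgue : {outer_measure set X -> \bar R} :=
  (lebesgue_outer : {outer_measure set 'rV[R]_n.+1 -> \bar R}).

Lemma lp_lebesgue_borel_regular : borel_regular lp_lebesgue.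
Proof.
split=> [B|A].
  have sigC : sigma_algebra setT lp_lebesgue.-caratheodory.
    split; first exact: caratheodory_measurable_set0.
    - by move=> A mA; rewrite setTD; exact: caratheodory_measurable_setC.
    - exact: caratheodory_measurable_bigcup.
  apply: (smallest_sub sigC) => U /open_bigcup_box ->; rewrite bigcup_mkcond.
  have mbox q : lp_lebesgue.-caratheodory (Q q).
    apply: (smallest_sub sigC (@subset_refl _ _)); apply: box_halfspaces => i c.
    by apply: sub_gen_smallest; exact: halfspace_caratheodory.
  apply: (@countable_bigcupT_measurable _ (caratheodory_type lp_lebesgue)) => // q.
  by case: ifP => _; [exact: mbox|exact: caratheodory_measurable_set0].
have borel_box q : <<s (@open X) >> (@box R n.+1 q).
  by apply: box_halfspaces => i c; apply: sub_gen_smallest; exact: open_halfspace.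
exact: (cover_outer_hull (@vol_ge0 R n.+1) borel_box).
Qed.

Lemma lp_lebesgue_ball2 (x : X) (r : R) :
  lp_lebesgue (ball x (2 * r)%R) = (2 ^+ n.+1)%:E * lp_lebesgue (ball x r).
Proof.
rewrite -(@lebesgue_outer_affine _ _ _ (- x)%R)//; congr (lp_lebesgue _).
rewrite !lp_ballE; apply/seteqP; split => [y /= xy|_ [y /= xy <-]] /=.
  (* The preimage of [y] under the dilation by 2 about [x] is their midpoint. *)
  exists (2^-1 *: (x + y : 'rV[R]_n.+1))%R; last first.
    by rewrite scalerA divff// scale1r addKr.
  have -> : ((x : 'rV[R]_n.+1) - 2^-1 *: (x + y : 'rV[R]_n.+1) = 2^-1 *: ((x : 'rV[R]_n.+1) - y))%R.
    by apply/rowP => i; rewrite !mxE; field.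
  by rewrite lp_normZ// mulrC ltr_pdivrMr// mulrC.
have -> : ((x : 'rV[R]_n.+1) - (- x + 2 *: (y : 'rV[R]_n.+1)) = 2 *: ((x : 'rV[R]_n.+1) - y))%R.
  by apply/rowP => i; rewrite !mxE; ring.
by rewrite lp_normZ// ltr_pM2l.
Qed.

(** Each ball contains a box of positive volume and lies in a box of finite volume. *)
Lemma lp_lebesgue_nontrivial : nontrivial_on_balls lp_lebesgue.
Proof.
move=> x r r0; apply/andP; split.
  pose d := (r / n.+2%:R)%R; have d0 : (0 < d)%R by rewrite divr_gt0.
  pose q : 'rV[R]_n.+1 * 'rV[R]_n.+1 := (x, (x + const_mx d)%R).
  apply: (@lt_le_trans _ _ (lp_lebesgue (box q))).
    rewrite [lp_lebesgue _]lebesgue_outer_box lte_fin.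
    by apply: prodr_gt0 => i _; rewrite !mxE lt_max addrAC subrr add0r d0.
  apply: le_outer_measure => y yq; rewrite lp_ballE/=.
  apply: (@le_lt_trans _ _ (n.+1%:R * d)%R).
    apply: lp_norm_le_coord => // i; rewrite !mxE distrC.
    have := yq i; rewrite !mxE => /andP[xy yx].
    by rewrite ler_norml; apply/andP; split; lra.
  by rewrite /d mulrCA gtr_pMr// ltr_pdivrMr// mul1r ltr_nat.
pose q : 'rV[R]_n.+1 * 'rV[R]_n.+1 := ((x - const_mx r)%R, (x + const_mx r)%R).
apply: (@le_lt_trans _ _ (lp_lebesgue (box q))).
  apply: le_outer_measure => y; rewrite lp_ballE/= => xy i.
  have := le_lt_trans (ler_coord_lp_norm p_ge1 _ i) xy.
  rewrite !mxE ltr_norml => /andP[? ?].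
  by apply/andP; split; lra.
by rewrite [lp_lebesgue _]lebesgue_outer_box ltry.
Qed.

Lemma least_doubling_constant_le :
  least_doubling_constant X <= (2 ^+ n.+1)%:E.
Proof.
apply: (@le_trans _ _ (doubling_constant lp_lebesgue)).
  apply: ereal_inf_lbound; exists lp_lebesgue => //; split.
  - exact: lp_lebesgue_borel_regular.
  - exact: lp_lebesgue_nontrivial.
  - exists (2 ^+ n.+1)%R => [|x r r0]; first by rewrite exprn_ege1// ler1n.
    by rewrite lp_lebesgue_ball2.
apply: ge_ereal_sup => _ [x [r [r0 ->]]].
have /andP[m0 moo] := lp_lebesgue_nontrivial x r0.
rewrite lp_lebesgue_ball2.
have mfin : lp_lebesgue (ball x r) \is a fin_num by rewrite ge0_fin_numE// ltW.
by rewrite -muleA divee ?mule1// gt_eqF.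
Qed.

End LpLebesgue.

(** * Lower bound: packing disjoint unit balls into a large ball *)

Lemma sum_trivIset_le {R : realType} {T : Type} (mu : {outer_measure set T -> \bar R})
    (J : eqType) (B : J -> set T) (A : set T) (s : seq J) :
  (forall i, mu.-caratheodory (B i)) -> trivIset setT B -> uniq s ->
  (\sum_(i <- s) mu (A `&` B i) <= mu A)%E.
Proof.
move=> mB tB; elim: s A => [|i s IH] A /=; first by rewrite big_nil outer_measure_ge0.
(* Measurability of [B i] splits off its share of [A]; by disjointness the other pieces survive in
   the remainder, to which the induction hypothesis applies. *)
move=> /andP[si us]; rewrite big_cons (mB i A) leeD2l//.
apply: le_trans (IH _ us); rewrite big_seq [leRHS]big_seq.
apply: lee_sum => j sj; apply: le_outer_measure => x [Ax Bjx]; do !split => //.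
move=> Bix; have ji := tB i j I I (ex_intro _ x (conj Bix Bjx)).
by rewrite ji sj in si.
Qed.

(** This removes the constant factor from the packing bound: if b < a, then c (b/a)^k tends to 0 and
    cannot stay at least 1. *)
Lemma ler_of_expr {R : realType} (a b c : R) : 0 <= b ->
  (forall k, a ^+ k <= c * b ^+ k) -> a <= b.
Proof.
move=> b0 H; rewrite leNgt; apply/negP => ba.
have a0 : 0 < a by exact: le_lt_trans ba.
have z1 : `|b / a| < 1 by rewrite ger0_norm ?divr_ge0 ?(ltW a0)// ltr_pdivrMr// mul1r.
have : c * (b / a) ^+ k @[k --> \oo] --> c * 0 by apply: cvgMl_tmp; exact: cvg_expr.
rewrite mulr0 => cz.
have [k _ /(_ k (leqnn k))] := cvgr_lt _ cz _ ltr01.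
apply/negP; rewrite -leNgt.
by rewrite expr_div_n mulrA ler_pdivlMr ?exprn_gt0// mul1r.
Qed.

Section LowerBound.
Context {R : realType} {n : nat} (p : \bar R) (p_ge1 : (1 <= p)%E).
Local Notation X := (lp_space n.+1 p_ge1).
Variables (mu : {outer_measure set X -> \bar R}) (C : R).
Hypothesis mu_borel : borel_regular mu.
Hypothesis mu_balls : nontrivial_on_balls mu.
Hypothesis C_ge0 : 0 <= C.
Hypothesis mu_ball2 : forall (x : X) (r : R), 0 < r ->
  (mu (ball x (2 * r)%R) <= C%:E * mu (ball x r))%E.

Lemma mu_ball_iter (x : X) k : (mu (ball x (2 ^+ k)%R) <= (C ^+ k)%:E * mu (ball x 1%R))%E.
Proof.
elim: k => [|k IH]; first by rewrite !expr0 mul1e.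
rewrite !exprS EFinM -muleA (le_trans (mu_ball2 _ _))// ?exprn_gt0//.
by rewrite lee_wpmul2l// lee_fin.
Qed.

Let pt k (f : {ffun 'I_n.+1 -> 'I_(2 ^ k)}) : X := (\row_i (2 * f i)%:R : 'rV[R]_n.+1).

(** Distinct grid points differ by at least 2 in some coordinate, while a common point of the open
    balls would be at distance less than 1 from both in that coordinate. *)
Let pt_trivIset k : trivIset setT (fun f => ball (pt (k := k) f) 1).
Proof.
move=> f g _ _ [y []]; rewrite !lp_ballE/= => fy gy.
apply/ffunP => i; apply/val_inj/eqP; apply: contraT => /= fg.
have := le_lt_trans (ler_coord_lp_norm p_ge1 _ i) fy.
have := le_lt_trans (ler_coord_lp_norm p_ge1 _ i) gy.
rewrite !mxE !ltr_norml => /andP[g1 g2] /andP[f1 f2].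
move: fg; rewrite neq_ltn => /orP[] fg; exfalso.
  have : (2 * f i)%:R + 2 <= (2 * g i)%:R :> R by rewrite -natrD ler_nat; lia.
  lra.
have : (2 * g i)%:R + 2 <= (2 * f i)%:R :> R by rewrite -natrD ler_nat; lia.
lra.
Qed.

(** Bounding the dimension factor n + 1 by 2^(n+1) keeps the radius a power of 2, as iterated
    doubling requires. *)
Let lp_norm_pt k f : lp_norm p (pt (k := k) f) <= 2 ^+ (n.+1 + k.+1).
Proof.
apply: (@le_trans _ _ (n.+1%:R * 2 ^+ k.+1)).
  apply: lp_norm_le_coord => // i; rewrite mxE ger0_norm// -natrX ler_nat.
  by rewrite expnS leq_mul2l ltnW.
by rewrite exprD ler_wpM2r ?exprn_ge0// -natrX ler_nat ltnW// ltn_expl.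
Qed.

Let o : X := (0 : 'rV[R]_n.+1).

(* The ball of radius [2 ^ (k + n + 3)] contains [2 ^ (k * (n + 1))] disjoint
   unit balls, each of which carries at least the fraction [C ^- (k + n + 4)]
   of its mass. *)
Lemma packing_bound k : (2 ^+ n.+1) ^+ k <= C ^+ (n.+4) * C ^+ k.
Proof.
(* One more than the exponent in [lp_norm_pt], to leave room for the unit radius around each grid
   point. *)
pose M := (n.+1 + k.+1).+1.
have /andP[m0 moo] := mu_balls o (exprn_gt0 M (@ltr0Sn R 1)).
have mfin : mu (ball o (2 ^+ M)) \is a fin_num.
  by rewrite ge0_fin_numE// ltW.
rewrite -exprD -lee_fin -(@lee_pmul2r _ (mu (ball o (2 ^+ M))))//.
have twice (x : R) : 2 * x = x + x by rewrite mulr2n mulrDl mul1r.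
have M1 f : lp_norm p (pt (k := k) f) + 1 <= 2 ^+ M.
  by rewrite exprS twice lerD ?lp_norm_pt// -natrX ler1n expn_gt0.
have sub1 f : ball (pt (k := k) f) 1 `<=` ball o (2 ^+ M).
  move=> y; rewrite !lp_ballE/= => fy; rewrite /o sub0r lp_normN.
  have -> : (y : 'rV[R]_n.+1) = (pt f : 'rV[R]_n.+1) + - ((pt f : 'rV[R]_n.+1) - y).
    by rewrite opprB addrC subrK.
  rewrite (le_lt_trans (lp_normD _ _ p_ge1))// lp_normN.
  by rewrite (lt_le_trans _ (M1 f))// ltrD2l.
(* Recentring at a grid point costs one more doubling, so M + 1 = k + n + 4 doublings lead from its
   unit ball to a ball containing the large one. *)
have sub2 f : ball o (2 ^+ M) `<=` ball (pt (k := k) f) (2 ^+ M.+1).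
  move=> y; rewrite !lp_ballE/= => fy.
  have -> : (pt f : 'rV[R]_n.+1) - y = (pt f : 'rV[R]_n.+1) + (o - (y : 'rV[R]_n.+1)).
    by rewrite /o sub0r.
  rewrite (le_lt_trans (lp_normD _ _ p_ge1))// exprS twice ler_ltD//.
  by rewrite (le_trans _ (M1 f))// lerDl.
have fraction f : (mu (ball o (2 ^+ M)) <=
    (C ^+ M.+1)%:E * mu (ball (pt (k := k) f) 1))%E.
  by apply: le_trans (mu_ball_iter _ _); exact: le_outer_measure.
have mball x r : mu.-caratheodory (ball (x : X) r).
  by apply: mu_borel.1; apply: sub_gen_smallest; exact: metric_ball_open.
have := @sum_trivIset_le _ _ mu _ _ (ball o (2 ^+ M))
  (index_enum {ffun 'I_n.+1 -> 'I_(2 ^ k)}) (fun f => mball (pt f) 1)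
  (@pt_trivIset k) (index_enum_uniq _).
under eq_bigr do rewrite setIidr//.
move=> sum_le.
have -> : (n.+4 + k = M.+1)%N by rewrite /M; lia.
apply: le_trans (lee_wpmul2l _ sum_le); last by rewrite lee_fin exprn_ge0.
rewrite ge0_sume_distrr; last by move=> f _; exact: outer_measure_ge0.
apply: le_trans (lee_sum _ (fun f _ => fraction f)).
(* All terms are now the mass of the large ball, so the sum counts the (2^k)^(n+1) grid points. *)
rewrite -(fineK mfin) sumEFin sumr_const -EFinM lee_fin card_ffun !card_ord.
by rewrite -[leRHS]mulr_natl !natrX exprAC.
Qed.

Lemma expn2_le_doubling : 2 ^+ n.+1 <= C.
Proof. exact: (ler_of_expr C_ge0 packing_bound). Qed.

End LowerBound.

(** A finite doubling constant is itself an admissible [C] in [expn2_le_doubling]; an infinite one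
    satisfies the bound trivially. *)
Lemma least_doubling_constant_ge {R : realType} (n : nat) (p : \bar R)
    (p_ge1 : (1 <= p)%E) :
  ((2 ^+ n.+1)%:E <= least_doubling_constant (lp_space n.+1 p_ge1))%E.
Proof.
apply: le_ereal_inf_tmp => _ [mu [mu_borel mu_balls _] ->].
have ratio_le (x : lp_space n.+1 p_ge1) (r : R) : 0 < r ->
    (mu (ball x (2 * r)) / mu (ball x r) <= doubling_constant mu)%E.
  by move=> r0; apply: ereal_sup_ubound; exists x, r.
(* This excludes the value [-oo] and supplies [0 <= C]. *)
have ratio_ge0 : (0 <= doubling_constant mu)%E.
  apply: le_trans (ratio_le (0 : 'rV[R]_n.+1) 1 ltr01).
  by rewrite mule_ge0 ?inve_ge0 ?outer_measure_ge0.
move: ratio_le ratio_ge0; case: (doubling_constant mu) => [C||]// ratio_le C0; last first.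
  by rewrite leey.
rewrite lee_fin; apply: (expn2_le_doubling mu_borel mu_balls) => // x r r0.
have /andP[m0 moo] := mu_balls x r r0; move: (ratio_le x r r0).
have mfin : mu (ball x r) \is a fin_num by rewrite ge0_fin_numE// ltW.
have m0' : 0 < fine (mu (ball x r)) by rewrite fine_gt0// m0.
by rewrite -(fineK mfin) inver gt_eqF// lee_pdivrMr.
Qed.

Theorem proposition5p1 (R : realType) (n : nat) (n_ge1 : (1 <= n)%N)
    (p : \bar R) (p_ge1 : (1 <= p)%E) :
  least_doubling_constant (lp_space n p_ge1) = (2 ^+ n)%:E.
Proof.
case: n n_ge1 => // n _; apply/eqP; rewrite eq_le.
by rewrite least_doubling_constant_le least_doubling_constant_ge.
Qed.
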